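(* Fix $n\ge2$, $m>0$, $\beta>0$ and $\gamma\in(0,1-1/n]$. For each $d\ge2$ let $(g_x)_{x\in\mathcal X}$ be the Gaussian free field without boundary on $\mathcal X=\{0,1,\ldots,n-1\}^d$ with binomially-weighted interaction of parameter $\gamma$, as defined in the context. Then for $(x,x')\in\mathcal X\times\mathcal X$, $$\mathrm{Cov}(g_x,g_{x'})=\frac{\delta_{x,x'}}{\beta(1+m^2)}+O\{(1-\gamma)^d\},\qquad d\to\infty .$$ In particular, among $\gamma\in(0,1-1/n]$, the convergence of the variance to its limiting value is fastest when $\gamma=1-1/n$; that is, writing $V_d(\gamma)=\mathrm{Var}(g_x)$ for parameter $\gamma$ and $V=1/\{\beta(1+m^2)\}$, for every $\gamma\in(0,1-1/n)$ one has $|V_d(1-1/n)-V|/|V_d(\gamma)-V|\to0$ as $d\to\infty$.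
   Context: $\rho(x,x')=|\{i:x_i\ne x_i'\}|$ is the Hamming distance; $R_i=\{(x,x')\in\mathcal X\times\mathcal X:\rho(x,x')=i\}$ (ordered pairs); $\kappa_i=\binom di(n-1)^i$. The Hamiltonian is $$H\{(\xi_x)_{x\in\mathcal X}\}=\frac14\sum_{i=1}^d\binom di\frac{\gamma^i(1-\gamma)^{d-i}}{\kappa_i}\sum_{(x,x')\in R_i}(\xi_x-\xi_{x'})^2+\frac{m^2}2\sum_{x\in\mathcal X}\xi_x^2 ,$$ and $(g_x)_{x\in\mathcal X}$ is the random vector in $\mathbb R^{\mathcal X}$ with density proportional to $e^{-\beta H}$. The variance $\mathrm{Var}(g_x)$ does not depend on $x$. *)

(* Defs.v *)
From HB Require Import structures.
From mathcomp Require Import all_boot all_order all_algebra.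
From mathcomp Require Import all_classical all_reals all_analysis measurable_realfun.

Set Implicit Arguments.
Unset Strict Implicit.
Unset Printing Implicit Defensive.

Import Order.TTheory GRing.Theory Num.Theory.
Import numFieldNormedType.Exports.

Local Open Scope classical_set_scope.
Local Open Scope ring_scope.

Section lebesgue_tuple.
Context {R : realType}.
Let RR := measurableTypeR R.

Definition tuple_cons N (p : RR * N.-tuple RR) : N.+1.-tuple RR :=
  [the N.+1.-tuple RR of p.1 :: p.2].

(* Lebesgue measure on R^N, as the N-fold product of the one-dimensional one. *)
Fixpoint lebesgue_tuple (N : nat) : set (N.-tuple RR) -> \bar R :=
  if N is N'.+1 then
    pushforward (lebesgue_measure \x @lebesgue_tuple N')%E (@tuple_cons N')
  else \d_[tuple].

Lemma measurable_tuple_cons N : measurable_fun [set: RR * N.-tuple RR] (@tuple_cons N).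
Proof. by apply: measurable_cons; [exact: measurable_fst|exact: measurable_snd]. Qed.

HB.instance Definition _ N := @isMeasurableFun.Build _ _ _ _ (@tuple_cons N)
  (@measurable_tuple_cons N).

Let tuple_uncons N (t : N.+1.-tuple RR) : RR * N.-tuple RR :=
  (thead t, [tuple of behead t]).

Let tuple_consK N : cancel (@tuple_cons N) (@tuple_uncons N).
Proof.
move=> [x t]; rewrite /tuple_uncons /tuple_cons /=; congr pair => //.
exact/val_inj.
Qed.

Let measurable_tuple_uncons N : measurable_fun setT (@tuple_uncons N).
Proof.
apply: measurable_fun_pair => /=; last exact: measurable_behead.
exact: measurable_tnth.
Qed.

Let lebesgue_tuple_ex N :
  exists m : {sigma_finite_measure set (N.-tuple RR) -> \bar R},
    m = @lebesgue_tuple N :> (set (N.-tuple RR) -> \bar R).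
Proof.
elim: N => [|N [m mE]] /=.
  by exists (\d_[tuple] : {sigma_finite_measure set (0.-tuple RR) -> \bar R}).
rewrite -mE.
pose mu := pushforward (lebesgue_measure \x m)%E (@tuple_cons N).
have sfmu : sigma_finite setT mu.
  have /sigma_finiteP[F [FT ndF Foo]] := sigma_finiteT (@lebesgue_measure R).
  have /sigma_finiteP[G [GT ndG Goo]] := sigma_finiteT m.
  exists (fun k => @tuple_uncons N @^-1` (F k `*` G k)).
    rewrite -preimage_bigcup (_ : \bigcup_k _ = setT)//.
    rewrite -subTset => -[x y] _.
    have [k _ Fx] : (\bigcup_k F k) x by rewrite -FT.
    have [l _ Gy] : (\bigcup_k G k) y by rewrite -GT.
    exists (maxn k l) => //; split.
      by move: x Fx; exact/subsetPset/ndF/leq_maxl.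
    by move: y Gy; exact/subsetPset/ndG/leq_maxr.
  move=> k; have [mF Fk] := Foo k; have [mG Gk] := Goo k; split.
    rewrite -[X in measurable X]setTI.
    by apply: measurable_tuple_uncons => //; exact: measurableX.
  rewrite /mu /pushforward -comp_preimage.
  rewrite (_ : _ \o _ = id); last by apply/funext => p /=; rewrite tuple_consK.
  by rewrite preimage_id product_measure1E// lte_mul_pinfty// ge0_fin_numE.
have mcons := @measurable_tuple_cons N.
pose H := Measure_isSigmaFinite.Build _ _ _ mu sfmu.
pose mu' : {sigma_finite_measure set _ -> \bar R} := HB.pack mu (H mcons).
by exists (mu' mcons).
Qed.

Let lebesgue_tuple0 N : @lebesgue_tuple N set0 = 0%E.
Proof. by have [m <-] := lebesgue_tuple_ex N; rewrite measure0. Qed.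

Let lebesgue_tuple_ge0 N A : (0 <= @lebesgue_tuple N A)%E.
Proof. by have [m <-] := lebesgue_tuple_ex N. Qed.

Let lebesgue_tuple_sigma_additive N : semi_sigma_additive (@lebesgue_tuple N).
Proof.
by have [m <-] := lebesgue_tuple_ex N; exact: measure_semi_sigma_additive.
Qed.

HB.instance Definition _ N := isMeasure.Build _ _ _ (@lebesgue_tuple N)
  (lebesgue_tuple0 N) (@lebesgue_tuple_ge0 N) (@lebesgue_tuple_sigma_additive N).

Let lebesgue_tuple_sigma_finite N : sigma_finite setT (@lebesgue_tuple N).
Proof. by have [m <-] := lebesgue_tuple_ex N; exact: sigma_finiteT. Qed.

HB.instance Definition _ N := Measure_isSigmaFinite.Build _ _ _
  (@lebesgue_tuple N) (lebesgue_tuple_sigma_finite N).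

End lebesgue_tuple.

Definition site (n d : nat) := {ffun 'I_d -> 'I_n}.

Definition hamming n d (x y : site n d) : nat := #|[set i | x i != y i]%SET|.

Definition shell n d (i : nat) : {set site n d * site n d} :=
  [set p | hamming p.1 p.2 == i]%SET.

Definition kappa (n d i : nat) : nat := ('C(d, i) * (n - 1) ^ i)%N.

Definition hamiltonian {R : realType} n d (m gamma : R) (xi : site n d -> R) : R :=
  4^-1 * (\sum_(1 <= i < d.+1)
            ('C(d, i)%:R * (gamma ^+ i * (1 - gamma) ^+ (d - i)) / (kappa n d i)%:R
             * \sum_(p in shell n d i) (xi p.1 - xi p.2) ^+ 2))
  + m ^+ 2 / 2 * \sum_(x : site n d) xi x ^+ 2.

(* R^X is identified with R^#|X| along the enumeration of the finite type X. *)
Definition flatten_config {R : realType} n d (xi : site n d -> R) :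
    #|{: site n d}|.-tuple (measurableTypeR R) :=
  [tuple xi (enum_val i) | i < #|{: site n d}|].

Definition unflatten_config {R : realType} n d
    (s : #|{: site n d}|.-tuple (measurableTypeR R)) : site n d -> R :=
  fun x => tnth s (enum_rank x).

(* A realization, on some probability space, of the random vector indexed by
   the sites whose joint law has Lebesgue density c * exp (- beta * H). *)
Record gff (R : realType) (n d : nat) (m beta gamma : R) := Gff {
  gff_display : measure_display ;
  gff_space : measurableType gff_display ;
  gff_prob : probability gff_space R ;
  gff_field :> site n d -> {RV gff_prob >-> R} ;
  gff_density : exists c : R,
    forall B : set (#|{: site n d}|.-tuple (measurableTypeR R)), measurable B ->
      gff_prob [set w | B (flatten_config (fun x => gff_field x w))] =
      (\int[@lebesgue_tuple R _]_(s in B)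
         (c * expR (- beta * hamiltonian m gamma (unflatten_config s)))%:E)%E }.

Definition gff_cov (R : realType) n d (m beta gamma : R)
    (g : gff n d m beta gamma) (x x' : site n d) : \bar R :=
  covariance (gff_prob g) (g x) (g x').

Definition gff_var (R : realType) n d (m beta gamma : R)
    (g : gff n d m beta gamma) (x : site n d) : \bar R :=
  variance (gff_prob g) (g x).

Section gff_existence.
Context {R : realType}.
Local Notation RR := (measurableTypeR R).

Lemma measurable_tnthR N (i : 'I_N) :
  measurable_fun [set: N.-tuple RR] (fun s => tnth s i : R).
Proof. exact: (measurable_tnth i). Qed.

Lemma measurable_prod_tnth N (f : RR -> R) : measurable_fun [set: RR] f ->
  measurable_fun [set: N.-tuple RR] (fun s => \prod_(i < N) f (tnth s i)).
Proof.
move=> mf; apply: measurable_prod => i _.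
by apply: (measurableT_comp mf); exact: measurable_tnth.
Qed.

Lemma integral_lebesgue_tuple_prod N (f : RR -> R) :
  measurable_fun [set: RR] f -> (forall x, 0 <= f x) ->
  (\int[lebesgue_measure]_x (f x)%:E = 1)%E ->
  (\int[@lebesgue_tuple R N]_s (\prod_(i < N) f (tnth s i))%:E = 1)%E.
Proof.
move=> mf f0 f1; elim: N => [|N IH].
  rewrite /= integral_dirac//=; last first.
    by apply/measurable_EFinP; exact: measurable_prod_tnth.
  by rewrite diracT mul1e big_ord0.
rewrite /= ge0_integral_pushforward//=; last 2 first.
- by apply/measurable_EFinP; exact: measurable_prod_tnth.
- by move=> s _; rewrite lee_fin prodr_ge0.
rewrite preimage_setT.
have mg : measurable_fun [set: RR * N.-tuple RR]
    (fun p => (\prod_(i < N.+1) f (tnth (tuple_cons p) i))%:E).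
  apply/measurable_EFinP.
  apply: (measurableT_comp (f := fun s : N.+1.-tuple RR => \prod_(i < N.+1) f (tnth s i))).
    exact: measurable_prod_tnth.
  exact: measurable_tuple_cons.
rewrite [LHS](_ : _ = \int[lebesgue_measure \x @lebesgue_tuple R N]_p
   (\prod_(i < N.+1) f (tnth (tuple_cons p) i))%:E)%E//.
rewrite fubini_tonelli1//=; last by move=> p; rewrite lee_fin prodr_ge0.
rewrite -f1; apply: eq_integral => x _; rewrite /fubini_F /=.
transitivity (\int[@lebesgue_tuple R N]_s
    ((f x)%:E * (\prod_(i < N) f (tnth s i))%:E))%E.
  apply: eq_integral => s _; rewrite big_ord_recl EFinM; congr (_ * _%:E)%E.
  by apply: eq_bigr => i _; rewrite tnthS; congr (f (tnth _ _)); exact/val_inj.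
rewrite ge0_integralZl//=; last 3 first.
- by apply/measurable_EFinP; exact: measurable_prod_tnth.
- by move=> s _; rewrite lee_fin prodr_ge0.
- by rewrite lee_fin.
by rewrite IH mule1.
Qed.

Lemma measurable_hamiltonian n d (m gamma : R) :
  measurable_fun [set: #|{: site n d}|.-tuple RR]
    (fun s => hamiltonian m gamma (unflatten_config s)).
Proof.
apply: measurable_funD; apply: measurable_funM => //; apply: measurable_sum.
- move=> i; apply: measurable_funM => //.
  pose F p (s : #|{: site n d}|.-tuple RR) :=
    if p \in shell n d i then
      (unflatten_config s p.1 - unflatten_config s p.2) ^+ 2 else 0.
  rewrite (_ : (fun s => _) = (fun s => \sum_p F p s)); last first.
    by apply/funext => s; rewrite big_mkcond.
  apply: measurable_sum => p; rewrite /F.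
  have [_|_] := boolP (p \in shell n d i) => /=; last exact: measurable_cst.
  by apply/measurable_funX/measurable_funB; exact: measurable_tnthR.
- by move=> x; apply: measurable_funX; exact: measurable_tnthR.
Qed.

Lemma hamiltonian_ge n d (m gamma : R) (xi : site n d -> R) :
  0 <= gamma <= 1 -> m ^+ 2 / 2 * (\sum_x xi x ^+ 2) <= hamiltonian m gamma xi.
Proof.
move=> /andP[g0 g1]; rewrite lerDr mulr_ge0// sumr_ge0// => i _.
rewrite mulr_ge0//; last by rewrite sumr_ge0// => p _; exact: sqr_ge0.
by rewrite !mulr_ge0// ?exprn_ge0// ?subr_ge0// invr_ge0.
Qed.

Definition gff_weight n d (m beta gamma : R)
    (s : #|{: site n d}|.-tuple RR) : R :=
  expR (- beta * hamiltonian m gamma (unflatten_config s)).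

Lemma measurable_gff_weight n d (m beta gamma : R) :
  measurable_fun setT (@gff_weight n d m beta gamma).
Proof.
apply: measurableT_comp => //; apply: measurable_funM => //.
exact: measurable_hamiltonian.
Qed.

Lemma gff_weight_le n d (m beta gamma : R) (s : #|{: site n d}|.-tuple RR) :
  0 < m -> 0 < beta -> 0 <= gamma <= 1 ->
  gff_weight m beta gamma s <=
  \prod_(i < #|{: site n d}|) normal_fun 0 (Num.sqrt beta * m)^-1 (tnth s i).
Proof.
move=> m0 b0 g01; rewrite /normal_fun -expR_sum ler_expR.
set c := beta * m ^+ 2 / 2.
rewrite (_ : \sum_(i < _) _ = - (c * \sum_(i < #|{: site n d}|) (tnth s i : R) ^+ 2)).
  rewrite mulNr lerN2 /c -2!mulrA ler_pM2l// mulrA.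
  apply: le_trans (hamiltonian_ge m _ g01).
  rewrite le_eqVlt; apply/orP; left; apply/eqP; congr (_ * _).
  rewrite [RHS](reindex (@enum_val _ (mem {: site n d})))/=.
    by apply: eq_bigr => i _; rewrite /unflatten_config enum_valK.
  exact/onW_bij/enum_val_bij.
rewrite mulr_sumr -sumrN; apply: eq_bigr => i _; rewrite subr0 mulNr; congr (- _).
rewrite exprVn exprMn sqr_sqrtr ?ltW// -mulr_natl invfM invrK /c.
by rewrite [RHS]mulrC; congr (_ * _); rewrite [LHS]mulrC.
Qed.

Let weight_mass n d (m beta gamma : R) :
  0 < m -> 0 < beta -> 0 <= gamma <= 1 ->
  exists2 Z : R, 0 < Z &
    (\int[@lebesgue_tuple R _]_s (@gff_weight n d m beta gamma s)%:E = Z%:E)%E.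
Proof.
move=> m0 b0 g01; set N := #|{: site n d}|.
pose sg := (Num.sqrt beta * m)^-1.
have sg0 : sg != 0 by rewrite invr_neq0// mulf_neq0 ?gt_eqF ?sqrtr_gt0.
have mpdf : measurable_fun [set: RR] (normal_pdf 0 sg).
  exact: measurable_normal_pdf.
have pdf1 := @integral_lebesgue_tuple_prod N _ mpdf
  (normal_pdf_ge0 0 sg) (integral_normal_pdf 0 sg).
have mw := @measurable_gff_weight n d m beta gamma.
have w0 s : 0 <= @gff_weight n d m beta gamma s by exact: expR_ge0.
pose I := (\int[@lebesgue_tuple R N]_s (@gff_weight n d m beta gamma s)%:E)%E.
have Ioo : (I < +oo)%E.
  pose K := (normal_peak sg)^-1 ^+ N.
  have K0 : 0 <= K by rewrite exprn_ge0// invr_ge0 normal_peak_ge0.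
  apply: (@le_lt_trans _ _ (\int[@lebesgue_tuple R N]_s
      (K%:E * (\prod_(i < N) normal_pdf 0 sg (tnth s i))%:E))%E).
    apply: ge0_le_integral => //=.
    - by move=> s _; rewrite lee_fin.
    - exact/measurable_EFinP.
    - apply/measurable_EFinP/measurable_funM => //.
      exact: measurable_prod_tnth.
    - move=> s _; rewrite lee_fin.
      apply: le_trans (gff_weight_le _ m0 b0 g01) _.
      rewrite /K -[X in _ ^+ X]card_ord -prodr_const -big_split/=.
      rewrite le_eqVlt; apply/orP; left; apply/eqP/eq_bigr => i _.
      by rewrite normal_pdfE// mulKf// gt_eqF// normal_peak_gt0.
  rewrite ge0_integralZl//=; last 2 first.
  - by apply/measurable_EFinP; exact: measurable_prod_tnth.
  - by move=> s _; rewrite lee_fin prodr_ge0// => i _; exact: normal_pdf_ge0.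
  by rewrite pdf1 mule1 ltry.
have I0 : (0 < I)%E.
  rewrite lt_neqAle integral_ge0 ?andbT; last by move=> s _; rewrite lee_fin.
  apply/eqP => /esym I0.
  have : ae_eq (@lebesgue_tuple R N) setT
      (EFin \o @gff_weight n d m beta gamma) (cst 0%E).
    apply/ae_eq_integral_abs => //; first exact/measurable_EFinP.
    rewrite -[RHS]I0; apply: eq_integral => s _ /=.
    by rewrite ger0_norm.
  move=> [A [mA A0 sA]].
  have AT : A = setT.
    rewrite -subTset => s _; apply: sA => /= /(_ Logic.I)[].
    by apply/eqP; rewrite gt_eqF// expR_gt0.
  have : (\int[@lebesgue_tuple R N]_s
      (\prod_(i < N) normal_pdf 0 sg (tnth s i))%:E = 0)%E.
    apply: null_set_integral => //; last by rewrite -AT.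
    by apply/measurable_EFinP; exact: measurable_prod_tnth.
  by rewrite pdf1 => /eqP; rewrite onee_eq0.
by exists (fine I); rewrite -/I ?fine_gt0 ?I0// fineK// ge0_fin_numE// ltW.
Qed.

Section law.
Variables (n d : nat) (m beta gamma Z : R).
Let N := #|{: site n d}|.
Hypothesis Z0 : 0 < Z.
Hypothesis ZE : (\int[@lebesgue_tuple R N]_s
  (@gff_weight n d m beta gamma s)%:E = Z%:E)%E.

Let f (s : N.-tuple RR) : \bar R := (Z^-1 * gff_weight m beta gamma s)%:E.
Let mf : measurable_fun setT f.
Proof.
apply/measurable_EFinP/measurable_funM => //; exact: measurable_gff_weight.
Qed.
Let f0 s : (0 <= f s)%E.
Proof. by rewrite lee_fin mulr_ge0 ?expR_ge0// invr_ge0 ltW. Qed.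

Let law (A : set (N.-tuple RR)) : \bar R := (\int[@lebesgue_tuple R N]_(s in A) f s)%E.
Let law0 : law set0 = 0%E. Proof. by rewrite /law integral_set0. Qed.
Let law_ge0 A : (0 <= law A)%E. Proof. exact: integral_ge0. Qed.
Let law_sigma_additive : semi_sigma_additive law.
Proof. exact: semi_sigma_additive_nng_induced. Qed.

HB.instance Definition _ := isMeasure.Build _ _ _ law law0 law_ge0 law_sigma_additive.

Let lawT : law setT = 1%E.
Proof.
rewrite /law /f; under eq_integral do rewrite EFinM.
rewrite ge0_integralZl//=.
- by rewrite ZE -EFinM mulVf// gt_eqF.
- by apply/measurable_EFinP; exact: measurable_gff_weight.
- by move=> s _; rewrite lee_fin expR_ge0.
- by rewrite lee_fin invr_ge0 ltW.
Qed.

HB.instance Definition _ := @Measure_isProbability.Build _ _ _ law lawT.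

Let coord (x : site n d) (s : N.-tuple RR) : R := tnth s (enum_rank x).
Let mcoord x : measurable_fun setT (coord x).
Proof. exact: measurable_tnthR. Qed.
HB.instance Definition _ x := @isMeasurableFun.Build _ _ _ _ (coord x) (mcoord x).

Let gff_of_mass : gff n d m beta gamma.
Proof.
apply: (@Gff R n d m beta gamma _ _ (law : probability _ R) (fun x => coord x : {mfun _ >-> _})).
exists Z^-1 => B mB /=.
congr (law _); apply/seteqP; split => s /=;
  suff -> : flatten_config (fun x => coord x s) = s by [];
  by apply: eq_from_tnth => i; rewrite tnth_mktuple /coord enum_valK.
Qed.

Lemma inhabited_of_mass : inhabited (gff n d m beta gamma).
Proof. exact: (inhabits gff_of_mass). Qed.

End law.

Lemma gff_inhabited n d (m beta gamma : R) :
  0 < m -> 0 < beta -> 0 <= gamma <= 1 -> inhabited (gff n d m beta gamma).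
Proof.
move=> m0 b0 g01; have [Z Z0 ZE] := @weight_mass n d m beta gamma m0 b0 g01.
exact: inhabited_of_mass Z0 ZE.
Qed.
End gff_existence.

(* Main.v *)
(* Idea: up to the binomial weights, H is (1/2) <xi, A xi> with
   A = (1 + m^2) I - P, where P is the d-fold tensor power of the kernel on
   {0, ..., n-1} that keeps a letter with probability 1 - gamma and otherwise
   moves to a uniform other letter; the covariance is S / beta with S = A^-1.
   Translating Lebesgue measure by a multiple of A^-1 u completes the square and
   gives the moment generating function of <u, g>, hence its first two moments.
   Finally D = S - I / a, where a = 1 + m^2, solves a D = P / a + P D.  Since P is
   stochastic with largest entry (1 - gamma)^d, attained on the diagonal (this is
   where gamma <= 1 - 1/n enters), the minimum principle yields
   0 <= D <= (1 - gamma)^d / (a (a - 1)) and D x x >= (1 - gamma)^d / a^2. *)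

Require Import Defs.
From HB Require Import structures.
From mathcomp Require Import all_boot all_order all_algebra.
From mathcomp Require Import all_classical all_reals all_analysis.
From mathcomp Require Import measurable_realfun ring lra.
Import Order.TTheory GRing.Theory Num.Theory.
Import numFieldNormedType.Exports.
Local Open Scope classical_set_scope.
Local Open Scope ring_scope.

(** * Translation invariance of Lebesgue measure on tuples *)

Section translation.
Context {R : realType}.
Local Notation RR := (measurableTypeR R).

(** Lebesgue measure is determined by its values on half-open intervals, and translation preserves
    their length. *)
Lemma lebesgue_measure_translation (a : R) (A : set RR) : measurable A ->
  pushforward lebesgue_measure (fun x : RR => x + a : RR) A = lebesgue_measure A.
Proof.
have ma : measurable_fun [set: RR] (fun x : RR => x + a : RR).
  by apply: measurable_funD => //; exact: measurable_cst.
pose H := isMeasurableFun.Build _ _ _ _ _ ma.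
pose f : {mfun RR >-> RR} := HB.pack (fun x : RR => x + a : RR) H.
move=> mA; apply/esym.
apply: (@lebesgue_measure_unique R (pushforward lebesgue_measure f)) => //= _ [[b c]] _ <-.
rewrite /pushforward /f /=.
rewrite (_ : _ @^-1` _ = [set` `]b - a, c - a]]); last first.
  by apply/seteqP; split => x /=; rewrite !in_itv/= ltrBlDr lerBrDr.
rewrite !lebesgue_measure_itv/= !lte_fin ltrD2r -!EFinB (_ : c - a - (b - a) = c - b)//; ring.
Qed.

Lemma ge0_integral_translation (a : R) (f : RR -> \bar R) :
  measurable_fun [set: RR] f -> (forall x, 0 <= f x)%E ->
  (\int[lebesgue_measure]_x f (x + a)%R = \int[lebesgue_measure]_x f x)%E.
Proof.
move=> mf f0.
have ma : measurable_fun [set: RR] (fun x : RR => x + a : RR).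
  by apply: measurable_funD => //; exact: measurable_cst.
transitivity (\int[pushforward lebesgue_measure (fun x : RR => (x + a)%R : RR)]_x f x)%E.
  by rewrite ge0_integral_pushforward//= ?preimage_setT// => x _; exact: f0.
by apply: eq_measure_integral => A mA _; exact: lebesgue_measure_translation.
Qed.

Definition translate_tuple {N} (a : 'I_N -> R) (s : N.-tuple RR) : N.-tuple RR :=
  [tuple tnth s i + a i | i < N].

Lemma measurable_translate_tuple {N} (a : 'I_N -> R) :
  measurable_fun [set: N.-tuple RR] (translate_tuple a).
Proof.
apply/measurable_fun_tnthP => i.
rewrite (_ : _ \o _ = fun s => (tnth s i : R) + a i); last first.
  by apply/funext => s /=; rewrite tnth_mktuple.
by apply: measurable_funD => //; exact: measurable_tnthR.
Qed.

Lemma translate_tuple_cons {N} (a : 'I_N.+1 -> R) (p : RR * N.-tuple RR) :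
  translate_tuple a (tuple_cons p) =
  tuple_cons (p.1 + a ord0, translate_tuple (fun i => a (lift ord0 i)) p.2).
Proof.
apply: eq_from_tnth => i; rewrite tnth_mktuple; case: (unliftP ord0 i) => [j|] ->.
  by rewrite !tnthS/= tnth_mktuple.
by rewrite !tnth0.
Qed.

Lemma ge0_integral_tuple_cons N (f : N.+1.-tuple RR -> \bar R) :
  measurable_fun [set: N.+1.-tuple RR] f -> (forall s, 0 <= f s)%E ->
  (\int[@lebesgue_tuple R N.+1]_s f s =
   \int[lebesgue_measure]_x \int[@lebesgue_tuple R N]_s f (tuple_cons (x, s)))%E.
Proof.
move=> mf f0; rewrite /= ge0_integral_pushforward//=.
rewrite preimage_setT.
rewrite [LHS](_ : _ = \int[lebesgue_measure \x @lebesgue_tuple R N]_p f (tuple_cons p))%E//.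
rewrite fubini_tonelli1//=.
by apply: measurableT_comp => //; exact: measurable_tuple_cons.
Qed.

(** Induction on [N]: Tonelli splits off the first coordinate, the induction hypothesis shifts the
    others while it is held fixed, and one-dimensional invariance shifts it last. *)
Lemma ge0_integral_translate_tuple N (a : 'I_N -> R) (f : N.-tuple RR -> \bar R) :
  measurable_fun [set: N.-tuple RR] f -> (forall s, 0 <= f s)%E ->
  (\int[@lebesgue_tuple R N]_s f (translate_tuple a s) =
   \int[@lebesgue_tuple R N]_s f s)%E.
Proof.
elim: N a f => [|N IH] a f mf f0.
  by apply: eq_integral => s _; rewrite tuple0 [s]tuple0.
have mfc : measurable_fun [set: RR * N.-tuple RR] (fun p => f (tuple_cons p)).
  by apply: measurableT_comp => //; exact: measurable_tuple_cons.
rewrite !ge0_integral_tuple_cons//; last first.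
  by apply: measurableT_comp => //; exact: measurable_translate_tuple.
pose G x := (\int[@lebesgue_tuple R N]_s f (tuple_cons (x, s)))%E.
transitivity (\int[lebesgue_measure]_x G (x + a ord0)%R)%E.
  apply: eq_integral => x _; rewrite /G.
  under eq_integral do rewrite translate_tuple_cons/=.
  rewrite (IH _ (fun s => f (tuple_cons (x + a ord0, s))))//.
  by apply: measurableT_comp mfc _; exact: measurable_pair1.
apply: ge0_integral_translation; last by move=> x; exact: integral_ge0.
exact: (@measurable_fun_fubini_tonelli_F _ _ _ _ _ (@lebesgue_tuple R N) _ mfc (fun p => f0 _)).
Qed.

End translation.

(** [h] and the Radon-Nikodym derivative of [nu] have the same integral over every measurable set,
    hence agree almost everywhere, and the change of variables for the derivative carries over to
    [h]. *)
Lemma ge0_integral_density d (T : measurableType d) (R : realType)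
    (nu : {finite_measure set T -> \bar R})
    (mu : {sigma_finite_measure set T -> \bar R}) (h f : T -> \bar R) :
  measurable_fun [set: T] h -> (forall x, 0 <= h x)%E ->
  (forall A, measurable A -> nu A = \int[mu]_(x in A) h x)%E ->
  measurable_fun [set: T] f -> (forall x, 0 <= f x)%E ->
  (\int[nu]_x f x = \int[mu]_x (f x * h x))%E.
Proof.
move=> mh h0 nuE mf f0.
have numu : nu `<< mu.
  apply/null_content_dominatesP => A mA A0; rewrite nuE//.
  by apply: null_set_integral => //; exact: measurable_funTS.
rewrite -(Radon_Nikodym_SigmaFinite.change_of_variables numu)//.
have iRN := Radon_Nikodym_SigmaFinite.f_integrable numu.
apply: ae_eq_integral => //.
- by apply: emeasurable_funM => //; exact: measurable_int iRN.
- exact: emeasurable_funM.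
- apply: ae_eqe_mul2l; apply: integral_ae_eq => // A _ mA.
  by rewrite -nuE// -Radon_Nikodym_SigmaFinite.f_integral.
Qed.

(** * Mean and variance from a Gaussian moment generating function *)

Section mgf.
Context {R : realType}.

(** With $u=yt\ge0$, the sum of exponentials minus 2 is the square of $e^{u/2}-e^{-u/2}$, which lies
    between $u^2e^{-u}$ and $u^2e^u$, so the error is at most $u^3e^u$. The final majorant is $t^3$
    times a function of [y] alone, so it can be integrated and then divided by $t^2$. *)
Lemma cosh_second_order (t y : R) : 0 < t <= 1 ->
  `|expR (y * t) + expR (- y * t) - 2 - t ^+ 2 * y ^+ 2| <=
  6 * t ^+ 3 * (expR (y * 3) + expR (- y * 3)).
Proof.
move=> /andP[t0 t1].
wlog y0 : y / 0 <= y => [H|].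
  have [|yn] := leP 0 y; first exact: H.
  have := H (- y); rewrite oppr_ge0 (ltW yn) opprK sqrrN => /(_ isT).
  by rewrite [expR (- y * t) + _]addrC [expR (- y * 3) + _]addrC.
set u := y * t; set z := u / 2.
have u0 : 0 <= u by rewrite mulr_ge0// ltW.
have -> : expR u + expR (- y * t) - 2 = (expR z - expR (- z)) ^+ 2.
  rewrite sqrrB -!expRM_natr -expRD subrr expR0.
  rewrite (_ : z * 2 = u) /z; last by field.
  by rewrite (_ : - (u / 2) * 2 = - y * t) /u; [ring|field].
have -> : t ^+ 2 * y ^+ 2 = u ^+ 2 by rewrite /u; ring.
have eN : 1 - u <= expR (- u) by apply: expR_ge1Dx.
have euN : expR u * expR (- u) = 1 by rewrite -expRD subrr expR0.
have e0 : 0 < expR u := expR_gt0 u.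
have e1 : 1 <= expR u by rewrite -expR0 ler_expR.
have ez : expR z ^+ 2 = expR u by rewrite -expRM_natr /z; congr expR; field.
have ezN : expR (- z) ^+ 2 = expR (- u).
  by rewrite -expRM_natr /z; congr expR; field.
have ezz : expR z * expR (- z) = 1 by rewrite -expRD subrr expR0.
have up : (expR z - expR (- z)) ^+ 2 <= u ^+ 2 * expR u.
  rewrite -ez -exprMn lerXn2r ?nnegrE ?(mulr_ge0 u0) ?expR_ge0//.
    by rewrite subr_ge0 ler_expR /z; lra.
  have -> : expR z - expR (- z) = expR z * (1 - expR (- u)).
    by rewrite -ezN expr2 mulrBr mulr1 mulrA ezz mul1r.
  by rewrite [leRHS]mulrC ler_pM2l ?expR_gt0//; lra.
have lo : u ^+ 2 * expR (- u) <= (expR z - expR (- z)) ^+ 2.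
  rewrite -ezN -exprMn lerXn2r ?nnegrE ?(mulr_ge0 u0) ?expR_ge0//.
    by rewrite subr_ge0 ler_expR /z; lra.
  have -> : expR z - expR (- z) = expR (- z) * (expR u - 1).
    by rewrite -ez expr2 mulrBr mulr1 mulrA [X in X * _ - _]mulrC ezz mul1r.
  by rewrite [leLHS]mulrC ler_pM2l ?expR_gt0// lerBrDl; exact: expR_ge1Dx.
have u30 : 0 <= u ^+ 3 by exact: exprn_ge0.
have eu1 : expR u <= 1 + u * expR u by nra.
have uu : u ^+ 2 * u = u ^+ 3 by ring.
have main : `|(expR z - expR (- z)) ^+ 2 - u ^+ 2| <= u ^+ 3 * expR u.
  have u20 : 0 <= u ^+ 2 by exact: exprn_ge0.
  have := ler_wpM2l u20 eN; have := ler_wpM2l u20 eu1.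
  have := ler_wpM2l u30 e1.
  rewrite ler_norml !mulrDr !mulr1 mulrN mulrA uu => ? ? ?.
  by apply/andP; split; lra.
apply: (le_trans main); rewrite /u.
rewrite (_ : (y * t) ^+ 3 * _ = t ^+ 3 * (y ^+ 3 * expR (y * t))); last by ring.
rewrite (_ : 6 * t ^+ 3 * _ = t ^+ 3 * (6 * (expR (y * 3) + expR (- y * 3)))); last by ring.
rewrite ler_pM2l ?exprn_gt0//.
(* The cubic term of the exponential series; combined with $e^{yt}\le e^{2y}$ it yields
   $6e^{3y}$. *)
have y3 : y ^+ 3 <= 6 * expR y.
  have := expR_ge1Dxn 2 y0; rewrite (_ : 3`!%:R = 6 :> R)// => ?; lra.
have ey : expR (y * t) <= expR (y * 2).
  by rewrite ler_expR ler_wpM2l//; lra.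
apply: (@le_trans _ _ (6 * expR y * expR (y * 2))).
  by apply: ler_pM; rewrite ?exprn_ge0 ?expR_ge0.
rewrite -mulrA -expRD ler_pM2l// (_ : y + y * 2 = y * 3); last by ring.
by rewrite lerDl expR_ge0.
Qed.

(** This takes the limit $t\to0$ in the moment estimates below. If $x>0$, the choice $t=x/(|C|+x)$
    forces $|C|+x\le C$, which is absurd. *)
Lemma le0_of_small_multiples (x C : R) :
  (forall t, 0 < t <= 1 -> x <= t * C) -> x <= 0.
Proof.
move=> H; rewrite leNgt; apply/negP => x0.
have den : 0 < `|C| + x by rewrite ltr_wpDl.
have := H (x / (`|C| + x)).
rewrite divr_gt0//= ler_pdivrMr// mul1r lerDr normr_ge0 => /(_ isT).
rewrite mulrAC ler_pdivlMr// ler_pM2l// => h.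
by have := ler_norm C; lra.
Qed.

Context d (T : measurableType d) (P : probability T R).

Section gaussian_mgf.
Variables (Y : T -> R) (v : R).
Hypothesis mY : measurable_fun [set: T] Y.
Hypothesis mgf : forall t, 'M_P Y t = (expR (v * t ^+ 2 / 2))%:E.

Let mexp t : measurable_fun [set: T] (fun w => expR (Y w * t)).
Proof. by apply: measurableT_comp => //; exact: measurable_funM. Qed.

Let int_exp t : (\int[P]_w (expR (Y w * t))%:E = (expR (v * t ^+ 2 / 2))%:E)%E.
Proof. by rewrite -mgf /mmt_gen_fun unlock. Qed.

Let integrable_exp t : P.-integrable setT (EFin \o (fun w => expR (Y w * t))).
Proof.
apply/integrableP; split; first exact/measurable_EFinP.
under eq_integral => w _ do rewrite /= ger0_norm ?expR_ge0//.
by rewrite int_exp ltry.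
Qed.

Let integrable_cosh t :
  P.-integrable setT (EFin \o (fun w => expR (Y w * t) + expR (- Y w * t))).
Proof.
have := integrableD measurableT (integrable_exp t) (integrable_exp (- t)).
by congr (_.-integrable _ _); apply/funext => w /=; rewrite -EFinD mulrN mulNr.
Qed.

Let Rint_cosh t : \int[P]_w (expR (Y w * t) + expR (- Y w * t)) =
  2 * expR (v * t ^+ 2 / 2).
Proof.
under eq_Rintegral => w _ do rewrite mulNr -mulrN.
rewrite RintegralD//; rewrite /Rintegral !int_exp/= sqrrN; ring.
Qed.

Let Rint_cst (c : R) : \int[P]_w c = c.
Proof. by rewrite Rintegral_cst//= probability_setT/= mulr1. Qed.

Let integrable_cst (c : R) : P.-integrable setT (EFin \o (fun _ => c)).
Proof. exact: finite_measure_integrable_cst. Qed.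

Let cosh_ge (y : R) : 2 + y ^+ 2 / 2 <= 2 * (expR y + expR (- y)).
Proof.
wlog y0 : y / 0 <= y => [H|].
  have [|yn] := leP 0 y; first exact: H.
  have := H (- y); rewrite oppr_ge0 (ltW yn) opprK sqrrN => /(_ isT).
  by rewrite [expR (- y) + _]addrC.
have := expR_ge1Dxn 1 y0; rewrite (_ : 2`!%:R = 2 :> R)// => ?.
have := expR_ge0 (- y); have := sqr_ge0 y; lra.
Qed.

Let integrable_sqr : P.-integrable setT (EFin \o (fun w => Y w ^+ 2)).
Proof.
(* The factor 4 comes from [cosh_ge], which gives $Y^2\le4(e^Y+e^{-Y})$. *)
have i1 := integrableZl measurableT 4 (integrable_cosh 1).
apply: le_integrable i1 => //.
  by apply/measurable_EFinP; exact: measurable_funX.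
move=> w _ /=; rewrite lee_fin (ger0_norm (sqr_ge0 _)) ger0_norm; last first.
  by rewrite mulr_ge0// addr_ge0// expR_ge0.
by have := cosh_ge (Y w); rewrite !mulr1; have := sqr_ge0 (Y w); lra.
Qed.

Lemma Lfun2_gaussian_mgf : Y \in Lfun P 2%:E.
Proof.
rewrite inE/=; apply/andP; split; rewrite inE//=.
rewrite /finite_norm unlock poweR_lty//.
under eq_integral => x _/= do rewrite powR_mulrn// real_normK ?num_real//.
exact: integrable_lty integrable_sqr.
Qed.

(** The sign of [v] is deduced rather than assumed: integrating $e^Y+e^{-Y}\ge2$ gives
    $e^{v/2}\ge1$. *)
Let mgf_ge0 : 0 <= v.
Proof.
have : 2 <= \int[P]_w (expR (Y w * 1) + expR (- Y w * 1)).
  rewrite -[leLHS]Rint_cst; apply: le_Rintegral => // w _.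
  have := expR_ge1Dx (Y w); have := expR_ge1Dx (- Y w); rewrite !mulr1; lra.
rewrite Rint_cosh expr1n mulr1 -[leLHS]mulr1 ler_pM2l// -[leLHS]expR0 ler_expR; lra.
Qed.

Let expB1_le t : 0 < t <= 1 ->
  expR (v * t ^+ 2 / 2) - 1 <= v * t ^+ 2 / 2 * expR (v / 2).
Proof.
move=> /andP[t0 t1]; set a := _ / 2.
have a0 : 0 <= a by rewrite mulr_ge0// mulr_ge0// sqr_ge0.
have av : a <= v / 2.
  rewrite /a ler_pM2r// -[leRHS]mulr1 ler_wpM2l// expr_le1// ltW//.
(* This is $1-a\le e^{-a}$ multiplied by $e^a$. *)
have h : expR a - 1 <= a * expR a.
  have := expR_ge1Dx (- a); rewrite -(ler_pM2l (expR_gt0 a)).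
  by rewrite -expRD subrr expR0 mulrDr mulr1; lra.
by apply: (le_trans h); apply: ler_wpM2l => //; rewrite ler_expR.
Qed.

Let int_Y : P.-integrable setT (EFin \o Y).
Proof.
apply/Lfun1_integrable; apply: Lfun_subset12 Lfun2_gaussian_mgf.
exact: fin_num_measure.
Qed.

(* e = 1 and e = -1 bound the mean from both sides. *)
Let mean_le (e : R) : e ^+ 2 = 1 -> e * \int[P]_w Y w <= 0.
Proof.
move=> e1; apply: (@le0_of_small_multiples _ (v / 2 * expR (v / 2))) => t t01.
have /andP[t0 t1] := t01.
(* After multiplication by [t], the inequality $z\le e^z-1$ at $z=etY$ bounds the left side by
   $e^{vt^2/2}-1$, which is of order $t^2$. *)
rewrite -(ler_pM2l t0) (_ : t * (t * _) = v * t ^+ 2 / 2 * expR (v / 2)); last first.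
  by ring.
apply: le_trans _ (expB1_le _ t01).
rewrite mulrA -RintegralZl//.
have -> : expR (v * t ^+ 2 / 2) - 1 = \int[P]_w (expR (Y w * (e * t)) - 1).
  rewrite (RintegralB measurableT (integrable_exp _) (integrable_cst 1)).
  by rewrite Rint_cst /Rintegral int_exp/= exprMn e1 mul1r.
apply: le_Rintegral => //.
- exact: (integrableZl measurableT (t * e) int_Y).
- have i1 := integrable_exp (e * t).
  exact: (integrableB measurableT i1 (integrable_cst 1)).
- by move=> w _; have := expR_ge1Dx (Y w * (e * t)); rewrite (mulrC (t * e)) (mulrC t); lra.
Qed.

Lemma mean_gaussian_mgf : ('E_P[Y] = 0)%E.
Proof.
have h : \int[P]_w Y w = 0.
  apply/eqP; rewrite eq_le; apply/andP; split.
    by have := mean_le _ (expr1n _ 2); rewrite mul1r.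
  by have := @mean_le (-1); rewrite sqrrN expr1n mulN1r oppr_le0; exact.
rewrite unlock -[LHS]fineK; last exact: integrable_fin_num.
by rewrite -[fine _]/(\int[P]_w Y w) h.
Qed.

(** Integrating [cosh_second_order] gives $2e^{vt^2/2}-2=t^2E[Y^2]+O(t^3)$, while the left side is
    $vt^2+O(t^4)$. Dividing by $t^2$ and using both signs of [e] identifies the second moment. *)
Let second_moment (e : R) : e ^+ 2 = 1 -> e * (\int[P]_w (Y w ^+ 2) - v) <= 0.
Proof.
move=> e1; pose K := \int[P]_w (expR (Y w * 3) + expR (- Y w * 3)).
(* [6 * K] is the integrated error of [cosh_second_order]; the other constant bounds the error of
   replacing $2e^{vt^2/2}-2$ by $vt^2$, with $t^4$ weakened to $t^3$. *)
apply: (@le0_of_small_multiples _ (6 * K + v ^+ 2 / 2 * expR (v / 2))) => t t01.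
have /andP[t0 t1] := t01.
have ht : `|2 * expR (v * t ^+ 2 / 2) - 2 - t ^+ 2 * \int[P]_w (Y w ^+ 2)|
    <= 6 * t ^+ 3 * K.
  have i1 : P.-integrable setT (EFin \o
      (fun w => expR (Y w * t) + expR (- Y w * t) - 2)).
    exact: (integrableB measurableT (integrable_cosh t) (integrable_cst 2)).
  have i2 : P.-integrable setT (EFin \o (fun w => t ^+ 2 * Y w ^+ 2)).
    exact: (integrableZl measurableT (t ^+ 2) integrable_sqr).
  have i3 : P.-integrable setT (EFin \o
      (fun w => expR (Y w * t) + expR (- Y w * t) - 2 - t ^+ 2 * Y w ^+ 2)).
    exact: (integrableB measurableT i1 i2).
  rewrite -Rint_cosh -[X in _ - X - _]Rint_cst -RintegralZl// -RintegralB//.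
  rewrite -[X in `|X|]RintegralB// -RintegralZl//.
  apply: (le_trans (le_normr_Rintegral _ i3)) => //.
  apply: le_Rintegral => //.
  - exact: (integrable_abse i3).
  - exact: (integrableZl measurableT (6 * t ^+ 3) (integrable_cosh 3)).
  - by move=> w _; exact: cosh_second_order.
have he := expB1_le _ t01.
have hl := expR_ge1Dx (v * t ^+ 2 / 2).
set M := \int[P]_w (Y w ^+ 2) in ht *.
set E := expR _ in ht he hl.
have t3 : t ^+ 4 <= t ^+ 3 by rewrite exprS ler_piMl// exprn_ge0// ltW.
have t20 : 0 <= v * t ^+ 2 / 2 by rewrite mulr_ge0// mulr_ge0// sqr_ge0.
set c := expR (v / 2) in he *.
have c0 : 0 <= c := expR_ge0 _.
have v2 : 0 <= v ^+ 2 / 2 * c by rewrite mulr_ge0// mulr_ge0// sqr_ge0.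
have E1 : 2 * E - 2 - v * t ^+ 2 <= t ^+ 3 * (v ^+ 2 / 2 * c).
  apply: (@le_trans _ _ (t ^+ 4 * (v ^+ 2 / 2 * c))); last exact: ler_wpM2r.
  have h : E - 1 <= v * t ^+ 2 / 2 * E.
    have := expR_ge1Dx (- (v * t ^+ 2 / 2)); rewrite -(ler_pM2l (expR_gt0 (v * t ^+ 2 / 2))).
    by rewrite -expRD subrr expR0 mulrDr mulr1 -/E; lra.
  have := ler_wpM2l t20 he; nra.
rewrite -(ler_pM2l (exprn_gt0 2 t0)).
have -> : t ^+ 2 * (t * (6 * K + v ^+ 2 / 2 * c)) =
  6 * t ^+ 3 * K + t ^+ 3 * (v ^+ 2 / 2 * c) by ring.
have := mulr_ge0 (exprn_ge0 3 (ltW t0)) v2.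
move: ht; rewrite ler_norml => /andP[ht1 ht2].
have /orP[/eqP ->|/eqP ->] : (e == 1) || (e == -1) by rewrite -sqrf_eq1 e1.
  by lra.
by lra.
Qed.

Lemma variance_gaussian_mgf : 'V_P[Y] = v%:E.
Proof.
rewrite varianceE ?Lfun2_gaussian_mgf// mean_gaussian_mgf.
have h : \int[P]_w (Y w ^+ 2) = v.
  apply/eqP; rewrite -subr_eq0 eq_le; apply/andP; split.
    by have := second_moment _ (expr1n _ 2); rewrite mul1r.
  by have := @second_moment (-1); rewrite sqrrN expr1n mulN1r oppr_le0; exact.
rewrite expe2 mule0 sube0 unlock -[LHS]fineK; last exact: integrable_fin_num.
by congr EFin; exact: h.
Qed.

End gaussian_mgf.
End mgf.

(** * Minimum principle and resolvent of a stochastic kernel *)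

Section resolvent.
Context {R : realType} {T : finType}.
Variables (P : T -> T -> R) (a : R).
Hypothesis P_ge0 : forall x y, 0 <= P x y.
Hypothesis P_row : forall x, \sum_y P x y = 1.
Hypothesis a_gt1 : 1 < a.

(** At a minimum point [x0], averaging [f] against a row of [P] gives [f x0 <= a * f x0], and
    [1 < a] makes the minimum nonnegative. *)
Lemma supersolution_ge0 (f : T -> R) :
  (forall x, \sum_y P x y * f y <= a * f x) -> forall x, 0 <= f x.
Proof.
move=> Hf x; pose x0 := [arg min_(z < x) f z]%O.
have fmin z : f x0 <= f z by rewrite /x0; case: arg_minP => // i _; exact.
apply: le_trans (fmin x).
have : f x0 <= a * f x0.
  apply: le_trans (Hf x0); rewrite -[leLHS]mul1r -(P_row x0) mulr_suml.
  by apply: ler_sum => y _; exact: ler_wpM2l.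
rewrite -subr_ge0 (_ : _ - _ = (a - 1) * f x0); last by ring.
by rewrite pmulr_rge0// subr_gt0.
Qed.

(** The minimum principle, applied to a null vector of $aI-P$ and to its opposite, makes this matrix
    injective, hence invertible. *)
Lemma resolvent_exists : exists S : T -> T -> R,
  forall x z, a * S x z - \sum_y P x y * S y z = (x == z)%:R.
Proof.
pose A := \matrix_(i < #|T|, j < #|T|)
  (a * (i == j)%:R - P (@enum_val T T i) (@enum_val T T j)).
have AE (s : T -> R) x : \sum_j A (enum_rank x) j * s (@enum_val T T j) =
    a * s x - \sum_y P x y * s y.
  rewrite [X in _ = _ - X](reindex (@enum_val T T))/=; last first.
    exact/onW_bij/enum_val_bij.
  under eq_bigr do rewrite mxE mulrBl.
  rewrite sumrB; congr (_ - _); last first.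
    by apply: eq_bigr => j _; congr (P _ _ * _); exact: enum_rankK.
  rewrite (bigD1 (enum_rank x))//= eqxx mulr1 (enum_rankK x : @enum_val T T _ = x) big1 ?addr0// => j.
  by rewrite eq_sym => /negbTE ->; rewrite mulr0 mul0r.
(* [det0P] produces a row vector, so it is applied to the transpose in order to obtain a null vector
   of [A] itself. *)
have Ainv : A^T \in unitmx.
  rewrite unitmxE unitfE; apply/negP => /det0P[v v0] vA.
  have vE x : a * v ord0 (enum_rank x) - \sum_y P x y * v ord0 (enum_rank y) = 0.
    rewrite -AE; transitivity ((v *m A^T) ord0 (enum_rank x)); last by rewrite vA mxE.
    by rewrite mxE; apply: eq_bigr => j _; rewrite enum_valK !mxE mulrC.
  have v_ge0 x : 0 <= v ord0 (enum_rank x).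
    apply: (@supersolution_ge0 (fun x => v ord0 (enum_rank x))) => {}x.
    by rewrite /= -subr_ge0 vE.
  have v_le0 x : 0 <= - v ord0 (enum_rank x).
    apply: (@supersolution_ge0 (fun x => - v ord0 (enum_rank x))) => {}x.
    under eq_bigr do rewrite mulrN.
    by rewrite /= sumrN mulrN lerN2 -subr_le0 vE.
  case/negP: v0; apply/eqP/rowP => j; rewrite mxE -[j]enum_valK.
  by apply/eqP; rewrite eq_le v_ge0 andbT -oppr_ge0.
(* The indices are swapped because the transpose was inverted. *)
exists (fun x z => invmx A^T (enum_rank z) (enum_rank x)) => x z.
rewrite -(AE (fun x => invmx A^T (enum_rank z) (enum_rank x))).
have /matrixP/(_ (enum_rank z) (enum_rank x)) := mulVmx Ainv.
rewrite !mxE (inj_eq enum_rank_inj) eq_sym => <-.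
by apply: eq_bigr => j _; rewrite enum_valK !mxE mulrC.
Qed.

Variable S : T -> T -> R.
Hypothesis SE : forall x z, a * S x z - \sum_y P x y * S y z = (x == z)%:R.

(** The tail $\sum_{k\ge1}P^k/a^{k+1}$ of the Neumann series of [S]. *)
Let D x z := S x z - (x == z)%:R / a.

Let a_gt0 : 0 < a. Proof. exact: lt_trans ltr01 a_gt1. Qed.

Let DE x z : a * D x z = P x z / a + \sum_y P x y * D y z.
Proof.
have -> : \sum_y P x y * D y z = \sum_y P x y * S y z - P x z / a.
  rewrite /D; under eq_bigr do rewrite mulrBr mulrA.
  rewrite sumrB -mulr_suml [X in _ - X / a](bigD1 z)//= eqxx mulr1.
  by rewrite [X in _ - (_ + X) / a]big1 ?addr0// => y /negbTE ->; rewrite mulr0.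
by rewrite addrC subrK /D mulrBr mulrCA divff ?gt_eqF// mulr1 -SE subKr.
Qed.

(** By [DE], $aD-PD=P/a\ge0$, so each column of [D] is a supersolution. *)
Lemma resolvent_diff_ge0 x z : 0 <= S x z - (x == z)%:R / a.
Proof.
apply: (@supersolution_ge0 (fun x => D x z)) => {}x.
by rewrite DE lerDr divr_ge0// ltW.
Qed.

Lemma resolvent_diag_ge x : P x x / a ^+ 2 <= S x x - a^-1.
Proof.
have := DE x x; rewrite /D eqxx mul1r => h.
rewrite expr2 invfM mulrA ler_pdivrMr// [leRHS]mulrC h lerDl sumr_ge0// => y _.
by rewrite mulr_ge0// resolvent_diff_ge0.
Qed.

(** The operator $a-P$ sends the constant $p/(a(a-1))$ to $p/a$, which dominates $P/a$; the constant
    minus a column of [D] is therefore a supersolution. *)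
Lemma resolvent_diff_le (p : R) : (forall x y, P x y <= p) ->
  forall x z, S x z - (x == z)%:R / a <= p / (a * (a - 1)).
Proof.
move=> Pp x z; rewrite -subr_ge0.
apply: (@supersolution_ge0 (fun x => p / (a * (a - 1)) - D x z)) => {}x.
under eq_bigr do rewrite mulrBr.
rewrite sumrB -mulr_suml P_row mul1r [leRHS]mulrBr DE opprD addrA lerD2r lerBrDr.
rewrite -lerBrDl; apply: (@le_trans _ _ (p / a)); first by rewrite ler_pM2r ?invr_gt0.
rewrite le_eqVlt; apply/orP; left; apply/eqP; field.
by rewrite (gt_eqF a_gt0) subr_eq0 (gt_eqF a_gt1).
Qed.

End resolvent.

(** * The flip kernel and the Hamiltonian as a quadratic form *)

Section hamming_kernel.
Context {R : realType} {n d : nat}.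
Variables (gamma m : R).
Hypothesis n2 : (2 <= n)%N.
Hypothesis g01 : 0 < gamma <= 1 - n%:R^-1.

Definition flip_kernel (x y : site n d) : R :=
  \prod_i (if x i == y i then 1 - gamma else gamma / (n - 1)%:R).

Let n1_gt0 : 0 < (n - 1)%:R :> R. Proof. by rewrite ltr0n subn_gt0. Qed.

(** After clearing denominators this is $\gamma n\le n-1$, the upper bound on [gamma]. *)
Let flip_le : gamma / (n - 1)%:R <= 1 - gamma.
Proof.
have /andP[g0] := g01.
have n0 : 0 < n%:R :> R by rewrite ltr0n (leq_trans _ n2).
rewrite lerBrDr -lerBrDl => h.
rewrite ler_pdivrMr// natrB ?(leq_trans _ n2)//.
have : gamma * n%:R <= n%:R - 1.
  by rewrite -ler_pdivlMr// mulrBl divff ?gt_eqF// mul1r; lra.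
lra.
Qed.

Let gamma_lt1 : 0 < 1 - gamma.
Proof. by apply: lt_le_trans flip_le; rewrite divr_gt0//; case/andP: g01. Qed.

Lemma flip_kernel_ge0 x y : 0 <= flip_kernel x y.
Proof.
apply: prodr_ge0 => i _; case: ifP => _; first exact: ltW.
by rewrite divr_ge0// ltW//; case/andP: g01.
Qed.

Lemma flip_kernel_le x y : flip_kernel x y <= (1 - gamma) ^+ d.
Proof.
rewrite -[X in _ <= _ ^+ X]card_ord -prodr_const; apply: ler_prod => i _.
case: ifP => _; first by rewrite lexx ltW.
by rewrite flip_le divr_ge0// ltW//; case/andP: g01.
Qed.

Lemma flip_kernel_diag x : flip_kernel x x = (1 - gamma) ^+ d.
Proof.
rewrite -[X in _ ^+ X]card_ord -prodr_const.
by apply: eq_bigr => i _; rewrite eqxx.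
Qed.

Lemma flip_kernel_sym x y : flip_kernel x y = flip_kernel y x.
Proof. by apply: eq_bigr => i _; rewrite eq_sym. Qed.

Lemma flip_kernel_row x : \sum_y flip_kernel x y = 1.
Proof.
(* The sum over sites of a product is the product of the one-letter sums, each equal to
   $(1-\gamma)+(n-1)\cdot\gamma/(n-1)=1$. *)
rewrite /flip_kernel -(bigA_distr_bigA (fun (i : 'I_d) (j : 'I_n) =>
  if x i == j then 1 - gamma else gamma / (n - 1)%:R)) big1// => i _.
rewrite (bigD1 (x i))//= eqxx.
rewrite (eq_bigr (fun=> gamma / (n - 1)%:R)); last first.
  by move=> j; rewrite eq_sym => /negbTE ->.
rewrite sumr_const (_ : #|_| = (n - 1)%N); last first.
  by rewrite cardC1 card_ord subn1.
by rewrite -mulrnAr -mulr_natr mulVf ?gt_eqF// mulr1 subrK.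
Qed.

(** This is the interaction weight of the Hamiltonian, once its binomial coefficient is cancelled
    against the one in [kappa]. *)
Lemma flip_kernelE x y : flip_kernel x y =
  gamma ^+ hamming x y * (1 - gamma) ^+ (d - hamming x y)
    / (n - 1)%:R ^+ hamming x y.
Proof.
rewrite /flip_kernel (bigID (fun i => x i != y i))/=.
rewrite (eq_bigr (fun=> gamma / (n - 1)%:R)); last first.
  by move=> i /negbTE ->.
rewrite [X in _ * X](eq_bigr (fun=> 1 - gamma)); last first.
  by move=> i; rewrite negbK => ->.
rewrite !prodr_const.
have -> : #|[pred i | x i != y i]| = hamming x y.
  by rewrite /hamming; apply: eq_card => i; rewrite !inE.
have -> : #|[pred i | ~~ (x i != y i)]| = (d - hamming x y)%N.
  rewrite /hamming -[X in (X - _)%N]card_ord -(cardC [set i | x i != y i]%SET) addKn.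
  by apply: eq_card => i; rewrite !inE.
by rewrite exprMn exprVn; ring.
Qed.

(** Grouping pairs by distance turns the interaction into $\sum P(x,y)(\xi_x-\xi_y)^2$. Unit row
    sums and symmetry make this $2(|\xi|^2-\langle\xi,P\xi\rangle)$, which turns the factor 1/4 into
    1/2. *)
Lemma hamiltonianE (xi : site n d -> R) : hamiltonian m gamma xi =
  2^-1 * \sum_x xi x * ((1 + m ^+ 2) * xi x - \sum_y flip_kernel x y * xi y).
Proof.
have hamming_le (x y : site n d) : (hamming x y <= d)%N.
  by rewrite /hamming -[X in (_ <= X)%N]card_ord max_card.
have -> : hamiltonian m gamma xi = 4^-1 * (\sum_x \sum_y flip_kernel x y * (xi x - xi y) ^+ 2)
   + m ^+ 2 / 2 * \sum_x xi x ^+ 2.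
  congr (_ * _ + _).
  rewrite pair_big_dep/=.
  transitivity (\sum_(i < d.+1) \sum_(p : site n d * site n d | hamming p.1 p.2 == i)
      flip_kernel p.1 p.2 * (xi p.1 - xi p.2) ^+ 2).
    (* Distance 0 is absent from the Hamiltonian; its shell is the diagonal, where the differences
       vanish. *)
    rewrite [RHS]big_ord_recl [X in _ = X + _]big1 ?add0r; last first.
      move=> [x y] /=; rewrite /hamming cards_eq0 => /eqP/setP h.
      have -> : x = y by apply/ffunP => i; have := h i; rewrite !inE => /negbFE/eqP.
      by rewrite subrr expr0n/= mulr0.
    rewrite big_add1/= big_mkord; apply: eq_bigr => i _.
    rewrite mulr_sumr; apply: eq_big => [p|p]; rewrite ?inE// => /eqP hp.
    congr (_ * _); rewrite flip_kernelE hp /kappa natrM natrX.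
    have C0 : 'C(d, i.+1)%:R != 0 :> R by rewrite pnatr_eq0 -lt0n bin_gt0.
    by rewrite invfM mulrACA divff// mul1r.
  (* Distances are at most [d], so [inord] never falls back on its default value. *)
  rewrite (partition_big (fun p : site n d * site n d => inord (hamming p.1 p.2) : 'I_d.+1) xpredT)//=.
  apply: eq_bigr => i _; apply: eq_bigl => p.
  by rewrite -val_eqE/= inordK// ltnS.
have row x : \sum_y flip_kernel x y * xi x ^+ 2 = xi x ^+ 2.
  by rewrite -mulr_suml flip_kernel_row mul1r.
have -> : \sum_x \sum_y flip_kernel x y * (xi x - xi y) ^+ 2 =
   2 * (\sum_x xi x ^+ 2 - \sum_x xi x * \sum_y flip_kernel x y * xi y).
  transitivity (\sum_x \sum_y (flip_kernel x y * xi x ^+ 2 + flip_kernel x y * xi y ^+ 2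
      - 2 * (xi x * (flip_kernel x y * xi y)))).
    by apply: eq_bigr => x _; apply: eq_bigr => y _; ring.
  under eq_bigr do rewrite sumrB big_split/= row.
  rewrite sumrB big_split/= [X in _ + X - _]exchange_big/=.
  have -> : \sum_y \sum_x flip_kernel x y * xi y ^+ 2 = \sum_x xi x ^+ 2.
    apply: eq_bigr => y _; rewrite -[RHS]row.
    by apply: eq_bigr => x _; rewrite flip_kernel_sym.
  rewrite [RHS]mulrBr [X in _ = X - _]mulr_natl mulr2n; congr (_ - _).
  by rewrite [RHS]mulr_sumr; apply: eq_bigr => x _; rewrite -!mulr_sumr.
have -> : \sum_x xi x * ((1 + m ^+ 2) * xi x - \sum_y flip_kernel x y * xi y) =
   (1 + m ^+ 2) * (\sum_x xi x ^+ 2) - \sum_x xi x * \sum_y flip_kernel x y * xi y.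
  under eq_bigr do rewrite mulrBr.
  rewrite sumrB mulr_sumr; congr (_ - _); apply: eq_bigr => x _; ring.
by field.
Qed.

(** Completing the square: the operator of the quadratic form is self-adjoint and sends [v] to [u],
    so the cross term is $\langle u,\xi\rangle$. *)
Lemma hamiltonian_translate (xi v u : site n d -> R) :
  (forall x, (1 + m ^+ 2) * v x - \sum_y flip_kernel x y * v y = u x) ->
  hamiltonian m gamma (fun x => xi x - v x) =
  hamiltonian m gamma xi - \sum_x u x * xi x + 2^-1 * \sum_x u x * v x.
Proof.
move=> vu; rewrite !hamiltonianE.
pose L (f : site n d -> R) x := (1 + m ^+ 2) * f x - \sum_y flip_kernel x y * f y.
have Lsym f g : \sum_x f x * L g x = \sum_x g x * L f x.
  rewrite /L; under eq_bigr do rewrite mulrBr mulr_sumr.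
  under [RHS]eq_bigr do rewrite mulrBr mulr_sumr.
  rewrite !sumrB; congr (_ - _); first by apply: eq_bigr => x _; ring.
  rewrite exchange_big/=; apply: eq_bigr => x _; apply: eq_bigr => y _.
  by rewrite flip_kernel_sym; ring.
have LB x : L (fun x => xi x - v x) x = L xi x - u x.
  rewrite -vu /L; under eq_bigr do rewrite mulrBr.
  by rewrite sumrB; ring.
rewrite -/(L _ _); under eq_bigr do rewrite -/(L _ _).
have -> : \sum_x (xi x - v x) * L (fun x => xi x - v x) x =
   \sum_x xi x * L xi x - \sum_x v x * L xi x - \sum_x u x * xi x + \sum_x u x * v x.
  rewrite -!sumrB -big_split/=; apply: eq_bigr => x _; rewrite LB; ring.
have -> : \sum_x v x * L xi x = \sum_x u x * xi x.
  by rewrite Lsym; apply: eq_bigr => x _; rewrite /L vu mulrC.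
rewrite -[\sum_x xi x * _]/(\sum_x xi x * L xi x).
by field.
Qed.

End hamming_kernel.

(** * Moment generating function and covariance of the field *)

Section gff_covariance.
Context {R : realType} {n d : nat} {m beta gamma : R}.
Hypotheses (n2 : (2 <= n)%N) (b0 : 0 < beta).
Variable g : gff n d m beta gamma.
Local Notation N := #|{: site n d}|.
Local Notation P := (gff_prob g).
Local Notation RR := (measurableTypeR R).
Local Notation kern := (@flip_kernel R n d gamma).

Let flat (w : gff_space g) : N.-tuple RR := flatten_config (fun x => g x w).

Let mflat : measurable_fun setT flat.
Proof.
apply/measurable_fun_tnthP => i.
rewrite (_ : _ \o _ = g (enum_val i)); first by have H := measurable_funPT (g (enum_val i)); exact: H.
by apply/funext => w /=; rewrite tnth_mktuple.
Qed.

Let tilt (u : site n d -> R) (t : R) (s : N.-tuple RR) : R :=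
  expR (\sum_x u x * unflatten_config s x * t).

Let measurable_tilt u t : measurable_fun setT (tilt u t).
Proof.
apply: measurableT_comp => //; apply: measurable_sum => x.
by do 2 apply: measurable_funM => //; exact: measurable_tnthR.
Qed.

(** The exponentially tilted density is a constant times a translate of the density. Translation
    invariance and total mass one leave only that constant, so [c] is never evaluated. *)
Lemma gff_mgf (u v : site n d -> R) :
  (forall x, (1 + m ^+ 2) * v x - \sum_y kern x y * v y = u x) ->
  forall t, 'M_P (fun w => \sum_x u x * g x w) t =
    (expR ((\sum_x u x * v x) / beta * t ^+ 2 / 2))%:E.
Proof.
move=> vu t; have [c cE] := gff_density g.
pose h (s : N.-tuple RR) : \bar R := (c * gff_weight m beta gamma s)%:E.
pose H := isMeasurableFun.Build _ _ _ _ _ mflat.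
pose X : {mfun gff_space g >-> N.-tuple RR} := HB.pack flat H.
have lawE A : measurable A ->
    (distribution P X A = \int[@lebesgue_tuple R N]_(s in A) h s)%E.
  exact: cE.
(* [gff_density] leaves the sign of [c] open; a negative value would make the total mass at most 0
   instead of 1. *)
have c0 : 0 <= c.
  rewrite leNgt; apply/negP => c0.
  have : (\int[@lebesgue_tuple R N]_(s in setT) h s <= 0)%E.
    under eq_integral => s _ do rewrite -[h s]oppeK.
    rewrite integral_ge0N ?oppe_le0 ?integral_ge0// => s _;
      by rewrite oppe_ge0 lee_fin mulr_le0_ge0 ?expR_ge0// ltW.
  by rewrite -lawE// probability_setT lee_fin ler10.
have mh : measurable_fun setT h.
  by apply/measurable_EFinP/measurable_funM => //; exact: measurable_gff_weight.
have h0 s : (0 <= h s)%E by rewrite lee_fin mulr_ge0// expR_ge0.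
have mF : measurable_fun setT (EFin \o tilt u t) by exact/measurable_EFinP.
have F0 s : (0 <= (EFin \o tilt u t) s)%E by rewrite lee_fin expR_ge0.
transitivity (\int[distribution P X]_s (EFin \o tilt u t) s)%E.
  rewrite ge0_integral_distribution// /mmt_gen_fun unlock.
  apply: eq_integral => w _; congr (expR _)%:E; rewrite /= mulr_suml.
  apply: eq_bigr => x _; congr (_ * _ * _).
  by rewrite /unflatten_config tnth_mktuple enum_rankK.
rewrite (@ge0_integral_density _ _ _ (distribution P X) (@lebesgue_tuple R N) h)//.
set k := _ * t ^+ 2 / 2.
(* Under this shift $-\beta H$ gains the tilt $t\langle u,s\rangle$ and the constant $-k$. *)
pose a (i : 'I_N) := - (t / beta * v (enum_val i)).
transitivity (\int[@lebesgue_tuple R N]_s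
    ((expR k)%:E * h (translate_tuple a s)))%E.
  apply: eq_integral => s _; rewrite /h /= -!EFinM; congr (_%:E).
  rewrite mulrCA [RHS]mulrCA /gff_weight /tilt -!expRD; congr (c * expR _).
  have -> : unflatten_config (translate_tuple a s) =
      fun x => unflatten_config s x - t / beta * v x.
    by apply/funext => x; rewrite /unflatten_config tnth_mktuple /a enum_rankK.
  rewrite (@hamiltonian_translate _ _ _ _ _ n2 _ _ (fun x => t / beta * u x)); last first.
    move=> x; rewrite -vu mulrBr mulr_sumr; congr (_ - _); first by ring.
    by apply: eq_bigr => y _; ring.
  have -> : \sum_x t / beta * u x * unflatten_config s x =
      beta^-1 * \sum_x u x * unflatten_config s x * t.
    by rewrite mulr_sumr; apply: eq_bigr => x _; ring.
  have -> : \sum_x t / beta * u x * (t / beta * v x) =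
      (t / beta) ^+ 2 * \sum_x u x * v x.
    by rewrite mulr_sumr; apply: eq_bigr => x _; ring.
  by rewrite /k; field; rewrite gt_eqF.
rewrite ge0_integralZl//=; last first.
  exact: (measurableT_comp mh (measurable_translate_tuple a)).
rewrite ge0_integral_translate_tuple//.
by rewrite -lawE// probability_setT mule1.
Qed.

Variable S : site n d -> site n d -> R.
Hypothesis SE : forall x z,
  (1 + m ^+ 2) * S x z - \sum_y kern x y * S y z = (x == z)%:R.

Let mgf1 x t : 'M_P (g x) t = (expR (S x x / beta * t ^+ 2 / 2))%:E.
Proof.
have := @gff_mgf (fun z => (z == x)%:R) (S ^~ x) (SE ^~ x) t.
have sum1 (f : site n d -> R) : \sum_z (z == x)%:R * f z = f x.
  rewrite (bigD1 x)//= eqxx mul1r big1 ?addr0// => z /negbTE ->.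
  by rewrite mul0r.
rewrite sum1 => <-; congr ('M_P _ t).
by apply/funext => w; rewrite (sum1 (g ^~ w)).
Qed.

(** [gff_mgf] with [u] the sum of two indicators and [v] the sum of two columns of [S], in
    preparation for polarization. *)
Let mgf2 x y t : 'M_P (g x \+ g y) t =
  (expR ((S x x + S y y + (S x y + S y x)) / beta * t ^+ 2 / 2))%:E.
Proof.
have := @gff_mgf (fun z => (z == x)%:R + (z == y)%:R) (fun z => S z x + S z y) _ t.
have sum1 x0 (f : site n d -> R) : \sum_z (z == x0)%:R * f z = f x0.
  rewrite (bigD1 x0)//= eqxx mul1r big1 ?addr0// => z /negbTE ->.
  by rewrite mul0r.
under [X in X / beta]eq_bigr do rewrite mulrDl.
rewrite big_split/= !sum1 => h.
have -> : S x x + S y y + (S x y + S y x) = S x x + S x y + (S y x + S y y) by ring.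
rewrite -h; first congr ('M_P _ t).
  apply/funext => w; under eq_bigr do rewrite mulrDl.
  by rewrite big_split/= (sum1 x (g ^~ w)) (sum1 y (g ^~ w)).
move=> z; rewrite -!SE; under eq_bigr do rewrite mulrDr.
by rewrite big_split/=; ring.
Qed.

Let mg x : measurable_fun setT (g x). Proof. exact: measurable_funPT. Qed.

Lemma gff_varE x : gff_var g x = (S x x / beta)%:E.
Proof. exact: (@variance_gaussian_mgf R _ _ P _ _ (mg x) (mgf1 x)). Qed.

(** Polarization: the variance of the sum minus both variances is twice the covariance. The
    symmetrized form spares a proof that [S] is symmetric. *)
Lemma gff_covE x y : gff_cov g x y = ((S x y + S y x) / 2 / beta)%:E.
Proof.
have L2 z : (g z : _ -> R) \in Lfun P 2%:E.
  exact: (@Lfun2_gaussian_mgf R _ _ P _ _ (mg z) (mgf1 z)).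
have fin : P setT \is a fin_num by exact: fin_num_measure.
have Cfin : gff_cov g x y \is a fin_num.
  have XY := Lfun2_mul_Lfun1 (L2 x) (L2 y).
  exact: (covariance_fin_num (Lfun_subset12 fin (L2 x)) (Lfun_subset12 fin (L2 y)) XY).
have := varianceD (L2 x) (L2 y).
rewrite (@variance_gaussian_mgf R _ _ P _ _ _ (mgf2 x y)); last exact: measurable_funD.
rewrite [X in (_ = X + _ + _)%E -> _]gff_varE [X in (_ = _ + X + _)%E -> _]gff_varE.
rewrite -[covariance _ _ _]/(gff_cov g x y) -(fineK Cfin).
rewrite -EFinM -!EFinD => -[h]; congr (_%:E).
have -> : (S x y + S y x) / 2 / beta =
  ((S x x + S y y + (S x y + S y x)) / beta - (S x x / beta + S y y / beta)) / 2.
  by field; rewrite gt_eqF.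
by rewrite h; field; rewrite gt_eqF.
Qed.

End gff_covariance.

(** * Asymptotics in the dimension and comparison of the parameters *)

Theorem proposition4p4 (R : realType) (n : nat) (m beta : R)
    (hn : (2 <= n)%N) (hm : 0 < m) (hbeta : 0 < beta) :
  (forall gamma : R, 0 < gamma <= 1 - n%:R^-1 ->
    exists C : R, \forall d \near \oo,
      forall (g : gff n d m beta gamma) (x x' : site n d),
      (`|gff_cov g x x' - ((x == x')%:R / (beta * (1 + m ^+ 2)))%:E|
         <= (C * (1 - gamma) ^+ d)%:E)%E)
  /\
  (forall gamma : R, 0 < gamma < 1 - n%:R^-1 ->
    forall (g0 : forall d : nat, gff n d m beta (1 - n%:R^-1))
           (g : forall d : nat, gff n d m beta gamma)
           (x0 x : forall d : nat, site n d),
    let V : R := (beta * (1 + m ^+ 2))^-1 in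
    (\forall d \near \oo, fine (gff_var (g d) (x d)) != V) /\
    (`|fine (gff_var (g0 d) (x0 d)) - V| / `|fine (gff_var (g d) (x d)) - V|
       @[d --> \oo] --> (0 : R))).
Proof.
set a := 1 + m ^+ 2.
have a1 : 1 < a by rewrite ltrDl exprn_gt0.
have a0 : 0 < a by exact: lt_trans ltr01 a1.
have resolvent d gamma : 0 < gamma <= 1 - n%:R^-1 ->
    exists S : site n d -> site n d -> R,
      [/\ forall x z, a * S x z - \sum_y flip_kernel gamma x y * S y z = (x == z)%:R,
          forall x z, 0 <= S x z - (x == z)%:R / a <=
            (1 - gamma) ^+ d / (a * (a - 1)) &
          forall x, (1 - gamma) ^+ d / a ^+ 2 <= S x x - a^-1].
  move=> g01.
  have K0 := @flip_kernel_ge0 R n d gamma hn g01.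
  have K1 := @flip_kernel_row R n d gamma hn.
  have [S SE] := resolvent_exists _ _ K0 K1 a1.
  exists S; split => // [x z|x].
    rewrite (resolvent_diff_ge0 _ _ K0 K1 a1 _ SE)/=.
    exact: (resolvent_diff_le _ _ K0 K1 a1 _ SE _ (flip_kernel_le _ hn g01)).
  by rewrite -(flip_kernel_diag gamma x); exact: (resolvent_diag_ge _ _ K0 K1 a1 _ SE).
split=> [gamma g01|gamma /andP[g0 g1] G0 G x0 x V].
  (* The factor of the resolvent bound that does not depend on [d], divided by [beta]; the estimate
     holds for every [d]. *)
  exists ((a * (a - 1))^-1 / beta); near=> d => g x x'.
  have [S [SE SD _]] := resolvent d gamma g01.
  rewrite (gff_covE hn hbeta g _ SE) -EFinB /= lee_fin.
  (* The error is the average of two resolvent errors lying between 0 and the same bound, divided by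
     [beta]. *)
  have -> : (S x x' + S x' x) / 2 / beta - (x == x')%:R / (beta * a) =
      ((S x x' - (x == x')%:R / a) + (S x' x - (x' == x)%:R / a)) / 2 / beta.
    by rewrite [x' == x]eq_sym; field; rewrite !gt_eqF.
  have /andP[d0 d1] := SD x x'; have /andP[e0 e1] := SD x' x.
  rewrite ger0_norm; last first.
    by rewrite divr_ge0// ?(ltW hbeta)// divr_ge0// addr_ge0.
  rewrite [leRHS]mulrAC ler_pM2r ?invr_gt0// [leRHS]mulrC; lra.
have g01 : 0 < gamma <= 1 - n%:R^-1 by rewrite g0 ltW.
have n0 : 0 < n%:R :> R by rewrite ltr0n (leq_trans _ hn).
have h01 : 0 < (1 - n%:R^-1 : R) <= 1 - n%:R^-1.
  by rewrite lexx andbT subr_gt0 invf_lt1// ltr1n.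
have p0 : 0 < 1 - gamma by rewrite subr_gt0 (lt_trans g1)// gtrBl invr_gt0.
have VE s : s / beta - V = (s - a^-1) / beta.
  by rewrite mulrBl -invfM [a * _]mulrC.
have Vlow d : (1 - gamma) ^+ d / a ^+ 2 / beta <= fine (gff_var (G d) (x d)) - V.
  have [S [SE _ Sd]] := resolvent d gamma g01.
  rewrite (gff_varE hn hbeta (G d) _ SE) VE.
  by rewrite ler_pM2r ?invr_gt0.
(* At the extremal parameter $1-\gamma=1/n$, so the rate is $n^{-d}$. *)
have Vup d : 0 <= fine (gff_var (G0 d) (x0 d)) - V <=
    n%:R^-1 ^+ d / (a * (a - 1)) / beta.
  have [S [SE SD _]] := resolvent d _ h01.
  rewrite (gff_varE hn hbeta (G0 d) _ SE) VE.
  have := SD (x0 d) (x0 d); rewrite eqxx mul1r subKr => /andP[? ?].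
  by apply/andP; split; [rewrite divr_ge0// ltW|rewrite ler_pM2r ?invr_gt0].
(* Strict positivity of the lower bound excludes a vanishing denominator. *)
have low0 d : 0 < (1 - gamma) ^+ d / a ^+ 2 / beta.
  by rewrite !divr_gt0 ?exprn_gt0.
split.
  by near=> d; rewrite -subr_eq0 gt_eqF// (lt_le_trans (low0 d)).
(* The ratio of the two geometric rates, below 1 because [gamma] is strictly less than $1-1/n$. *)
pose q := n%:R^-1 / (1 - gamma).
have q01 : `|q| < 1.
  rewrite ger0_norm; last by rewrite divr_ge0// ?invr_ge0 ltW.
  by rewrite ltr_pdivrMr// mul1r; lra.
(* The quotient of the upper bound in [Vup] by the lower bound in [Vlow]. *)
pose ub d := (a / (a - 1)) * q ^+ d.
apply: (@squeeze_cvgr _ _ _ _ (fun=> 0) ub); last 2 first.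
- exact: cvg_cst.
- rewrite -[X in _ --> X](mulr0 (a / (a - 1))).
  by apply: cvgMr; exact: cvg_expr.
near=> d; rewrite divr_ge0//=.
have /andP[u0 u1] := Vup d; have l := Vlow d.
rewrite (ger0_norm u0) ger0_norm; last exact: le_trans (ltW (low0 d)) l.
rewrite ler_pdivrMr; last exact: lt_le_trans (low0 d) l.
apply: (le_trans u1); apply: (@le_trans _ _ (ub d * ((1 - gamma) ^+ d / a ^+ 2 / beta))).
  rewrite le_eqVlt; apply/orP; left; apply/eqP; rewrite /ub /q exprMn (exprVn (1 - gamma)).
  have := exprn_gt0 d p0; move: ((1 - gamma) ^+ d) (n%:R^-1 ^+ d) => p r pp.
  by field; rewrite (gt_eqF pp) (gt_eqF hbeta) (gt_eqF a0) subr_eq0 (gt_eqF a1).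
rewrite ler_wpM2l// mulr_ge0//; first by rewrite divr_ge0// ltW// subr_gt0.
by rewrite exprn_ge0// divr_ge0 ?invr_ge0// ltW.
Unshelve. all: by end_near.
Qed.
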